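(* Let $\Phi=(\phi_n)$, $\Psi=(\psi_n)$ be sequences in $\mathcal H$ and let $m=(m_n)$ be a complex scalar sequence. (i) If $\Phi$ is an NBB Bessel sequence for $\mathcal H$, then $M_{m,\Phi,\Psi}$ is unconditionally convergent if and only if $m\Psi$ is Bessel for $\mathcal H$. (ii) If $\Phi$ is a Riesz basis for $\mathcal H$, then the following are equivalent: $M_{m,\Phi,\Psi}$ is well defined on $\mathcal H$; $M_{m,\Phi,\Psi}$ is unconditionally convergent; $m\Psi$ is Bessel for $\mathcal H$; $M_{m,\Psi,\Phi}$ is well defined on $\mathcal H$; $M_{m,\Psi,\Phi}$ is unconditionally convergent. (iii) If $\Phi$ is a Riesz basis for $\mathcal H$ and $\Psi$ is NBB, and if $M_{m,\Phi,\Psi}$ (or $M_{m,\Psi,\Phi}$) is well defined on $\mathcal H$, then $m\in\ell^\infty$. The converse does not hold in general: for $\Phi$ a Riesz basis and $\Psi$ NBB, $m\in\ell^\infty$ does not in general imply that $M_{m,\Phi,\Psi}$ is well defined on $\mathcal H$, nor that $M_{m,\Psi,\Phi}$ is. (iv) If $\Phi$ and $\Psi$ are Riesz bases for $\mathcal H$, then $M_{m,\Phi,\Psi}$ is well defined on $\mathcal H$ if and only if $m\in\ell^\infty$. Moreover, under the hypotheses of (i) (respectively of (ii)): if in addition $m$ is NBB, then each of the equivalent assertions in (i) (respectively (ii)) implies that $\Psi$ is Bessel for $\mathcal H$; if in addition $m$ is semi-normalized, then each of the equivalent assertions in (i) (respectively (ii)) is equivalent to $\Psi$ being Bessel for $\mathcal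 H$.
   Context: $\mathcal H$ is a complex Hilbert space having an orthonormal basis $(e_n)_{n\in\mathbb N}$ indexed by $\mathbb N$; all sequences and sums are indexed by $\mathbb N$. The multiplier is $M_{m,\Phi,\Psi}f=\sum_{n=1}^\infty m_n\langle f,\psi_n\rangle\phi_n$ (and $M_{m,\Psi,\Phi}f=\sum_n m_n\langle f,\phi_n\rangle\psi_n$). It is well defined on $\mathcal H$ if the series converges in $\mathcal H$ for every $f\in\mathcal H$, and unconditionally convergent if for every $f\in\mathcal H$ the series converges unconditionally (i.e. it converges for every permutation of its terms). Notation: $m\Psi=(m_n\psi_n)$. A sequence $(x_n)$ of scalars or vectors is NBB (norm-bounded below) if $\inf_n\|x_n\|>0$ (absolute value for scalars). A scalar sequence $m$ is semi-normalized if there are constants $0<a\le b<\infty$ with $a\le|m_n|\le b$ for all $n$. A sequence $(\phi_n)$ in $\mathcal H$ is Bessel for $\mathcal H$ if there is $B<\infty$ with $\sum_n|\langle h,\phi_n\rangle|^2\le B\|h\|^2$ for all $h\in\mathcal H$. It is a Riesz basis for $\mathcal H$ if it is complete in $\mathcal H$ (its linear span is dense) and there are $0<A\le B<\infty$ with $A\sum|c_n|^2\le\|\sum c_n\phi_n\|^2\le B\sum|c_n|^2$ for all $(c_n)\in\ell^2$. *)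

(* Defs.v *)
From HB Require Import structures.
From mathcomp Require Import all_boot all_order all_algebra.
From mathcomp Require Import sesquilinear.
From mathcomp Require Import all_classical all_reals all_analysis.
From mathcomp Require Export complex.

Set Implicit Arguments.
Unset Strict Implicit.
Unset Printing Implicit Defensive.

Import Order.TTheory GRing.Theory Num.Theory.

Local Open Scope classical_set_scope.
Local Open Scope ring_scope.
Local Open Scope complex_scope.

(* Over the field R[i], `|x| is an element of R[i] (a nonnegative real);
   rnorm x is the same number read in R. *)
Definition rnorm (R : realType) (V : normedZmodType R[i]) (x : V) : R :=
  complex.Re `|x|.

Section Sequences.
Variable R : realType.

Definition nbb (V : normedZmodType R[i]) (x : nat -> V) : Prop :=
  0 < inf (range (fun n => rnorm (x n))).

Definition semi_normalized (m : nat -> R[i]) : Prop :=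
  exists a b : R,
    [/\ 0 < a, a <= b & forall n, a <= rnorm (m n) /\ rnorm (m n) <= b].

Definition in_linfty (m : nat -> R[i]) : Prop :=
  exists b : R, forall n, rnorm (m n) <= b.

Definition sqsum (c : nat -> R[i]) : \bar R :=
  (\sum_(0 <= n <oo) (rnorm (c n) ^+ 2)%:E)%E.

Definition in_l2 (c : nat -> R[i]) : Prop := (sqsum c < +oo)%E.

Variable H : completeNormedModType R[i].

Definition lin_span (x : nat -> H) : set H :=
  [set v | exists (N : nat) (c : nat -> R[i]), v = \sum_(n < N) c n *: x n].

Definition complete_in (x : nat -> H) : Prop := closure (lin_span x) = setT.

Definition unconditionally_cvg (u : nat -> H) : Prop :=
  forall sigma : nat -> nat, bijective sigma -> cvgn (series (u \o sigma)).

(* The convergence of sum_n c_n phi_n for every c in l^2, which the norm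
   inequalities presuppose, has to be required explicitly: limn of a divergent
   sequence is an arbitrary point. *)
Definition riesz_basis (phi : nat -> H) : Prop :=
  complete_in phi /\
  exists A B : R,
    [/\ 0 < A, A <= B &
      forall c : nat -> R[i], in_l2 c ->
        let s := series (fun n => c n *: phi n) in
        [/\ cvgn s,
            (A%:E * sqsum c <= (rnorm (limn s) ^+ 2)%:E)%E &
            ((rnorm (limn s) ^+ 2)%:E <= B%:E * sqsum c)%E]].

(* Forms of type {dot H for Num.conj} are linear in the first argument and
   conjugate-linear in the second. *)
Variable ip : {dot H for (@Num.conj R[i])}.

Definition orthonormal_basis (e : nat -> H) : Prop :=
  (forall i j, ip (e i) (e j) = (i == j)%:R) /\ complete_in e.

Definition bessel (phi : nat -> H) : Prop :=
  exists B : R, forall h : H,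
    (sqsum (fun n => ip h (phi n)) <= (B * rnorm h ^+ 2)%:E)%E.

Definition multiplier_term (m : nat -> R[i]) (Phi Psi : nat -> H) (f : H)
    (n : nat) : H :=
  (m n * ip f (Psi n)) *: Phi n.

Definition mult_well_defined (m : nat -> R[i]) (Phi Psi : nat -> H) : Prop :=
  forall f : H, cvgn (series (multiplier_term m Phi Psi f)).

Definition mult_unconditional (m : nat -> R[i]) (Phi Psi : nat -> H) : Prop :=
  forall f : H, unconditionally_cvg (multiplier_term m Phi Psi f).

Definition weighted (m : nat -> R[i]) (Psi : nat -> H) : nat -> H :=
  fun n => m n *: Psi n.

End Sequences.

(* Main.v *)
(* With c_k = <f, m_k psi_k>, up to moduli, the terms of M_{m,Phi,Psi} f are
   c_k phi_k, and those of M_{m,Psi,Phi} f are <f, phi_k> (m_k psi_k). If a sequence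
   is Bessel, its synthesis operator is bounded on l^2, and l^2 coefficients stay
   in l^2 under permutation, so m Psi Bessel gives unconditional convergence. In the
   other direction, an unconditionally convergent series in H has square-summable
   norms: with signs chosen greedily, |+-x_0 +- ... +- x_n|^2 dominates the sum of
   the |x_k|^2, while the signed partial sums are differences of partial sums of two
   convergent subseries. So (c_k) is in l^2 for each f, and the uniform boundedness
   principle makes m Psi Bessel. For a Riesz basis the lower bound replaces the
   unconditional convergence. The counterexample in (iii) is Phi = (e_n) and Psi
   constantly e_0, with m = 1. *)
Require Import Defs.
From HB Require Import structures.
From mathcomp Require Import all_boot all_order all_algebra.
From mathcomp Require Import sesquilinear.
From mathcomp Require Import all_classical all_reals all_analysis.
From mathcomp Require Import complex.
From mathcomp Require Import ring lra.

Import Order.TTheory GRing.Theory Num.Theory.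

Local Open Scope classical_set_scope.
Local Open Scope ring_scope.
Local Open Scope complex_scope.

(** * Norms over [R[i]], read as real numbers *)

Section Rnorm.
Context {R : realType} {V : normedZmodType R[i]}.
Implicit Types x y : V.

Lemma rnormE x : `|x| = (rnorm x)%:C.
Proof. by rewrite /rnorm RRe_real// normr_real. Qed.

Lemma rnorm_ge0 x : 0 <= rnorm x.
Proof. by rewrite -ler0c -rnormE. Qed.

Lemma rnorm0 : rnorm (0 : V) = 0.
Proof. by rewrite /rnorm normr0. Qed.

Lemma rnorm_eq0 x : (rnorm x == 0) = (x == 0).
Proof. by rewrite -(normr_eq0 x) rnormE (inj_eq (@complexI R)). Qed.

Lemma rnormN x : rnorm (- x) = rnorm x.
Proof. by rewrite /rnorm normrN. Qed.

Lemma rnormD x y : rnorm (x + y) <= rnorm x + rnorm y.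
Proof. by rewrite -lecR rmorphD/= -!rnormE ler_normD. Qed.

Lemma rnormB x y : rnorm (x - y) <= rnorm x + rnorm y.
Proof. by rewrite -(rnormN y) rnormD. Qed.

Lemma rnorm_sum {I : Type} (r : seq I) (P : pred I) (F : I -> V) :
  rnorm (\sum_(k <- r | P k) F k) <= \sum_(k <- r | P k) rnorm (F k).
Proof.
rewrite -lecR rmorph_sum/= -rnormE (le_trans (ler_norm_sum _ _ _))//.
by rewrite ler_sum// => k _; rewrite rnormE.
Qed.

End Rnorm.

Section RnormScalar.
Context {R : realType}.
Implicit Types a b : R[i].

Lemma rnormM a b : rnorm (a * b) = rnorm a * rnorm b.
Proof. by apply: complexI; rewrite rmorphM/= -!rnormE normrM. Qed.

Lemma rnormZ (V : normedModType R[i]) a (x : V) :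
  rnorm (a *: x) = rnorm a * rnorm x.
Proof. by apply: complexI; rewrite rmorphM/= -!rnormE normrZ. Qed.

Lemma rnorm_conj a : rnorm (Num.conj a) = rnorm a.
Proof. by rewrite /rnorm norm_conjC. Qed.

Lemma rnorm_real (r : R) : 0 <= r -> rnorm r%:C = r.
Proof. by move=> r0; rewrite /rnorm ger0_norm// ler0c. Qed.

Lemma rnorm_sqrE a : a * Num.conj a = (rnorm a ^+ 2)%:C.
Proof. by rewrite -normCK rnormE rmorphXn. Qed.

Lemma normRe_le_rnorm a : `|complex.Re a| <= rnorm a.
Proof. by rewrite -lecR -rnormE normc_ge_Re. Qed.

Lemma addC_conj a : a + Num.conj a = (2 * complex.Re a)%:C.
Proof. by rewrite mulr_natl rmorphMn/= -mulr_natl -addcJ. Qed.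

Lemma sum_cauchy_schwarz (a b : nat -> R) N :
  (\sum_(0 <= k < N) a k * b k) ^+ 2 <=
  (\sum_(0 <= k < N) a k ^+ 2) * (\sum_(0 <= k < N) b k ^+ 2).
Proof.
elim: N => [|N IHN]; first by rewrite !big_geq// expr0n mulr0.
rewrite !big_nat_recr//=; move: (a N) (b N) IHN => x y.
have := sumr_ge0 (index_iota 0 N) (fun k (_ : true) => sqr_ge0 (a k)).
have := sumr_ge0 (index_iota 0 N) (fun k (_ : true) => sqr_ge0 (b k)).
move: (\sum_(0 <= k < N) _) (\sum_(0 <= k < N) _) (\sum_(0 <= k < N) _).
move=> P A B B0 A0 PAB.
have : 2 * (P * (x * y)) <= A * y ^+ 2 + B * x ^+ 2.
  have AB0 : 0 <= A * y ^+ 2 + B * x ^+ 2.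
    by apply: addr_ge0; apply: mulr_ge0 => //; exact: sqr_ge0.
  rewrite (le_trans (ler_norm _))// -ler_sqr ?nnegrE// real_normK ?num_real//.
  (* The difference of the squares of the two sides is a square plus a nonnegative multiple of
     [A * B - P ^+ 2], which is nonnegative by induction. *)
  rewrite -subr_ge0 [leRHS](_ : _ = (A * y ^+ 2 - B * x ^+ 2) ^+ 2 +
    4 * ((A * B - P ^+ 2) * (x * y) ^+ 2)); last by ring.
  by rewrite addr_ge0 ?sqr_ge0// mulr_ge0// mulr_ge0 ?sqr_ge0// subr_ge0.
have -> : (P + x * y) ^+ 2 = P ^+ 2 + 2 * (P * (x * y)) + (x * y) ^+ 2 by ring.
have -> : (A + x ^+ 2) * (B + y ^+ 2) =
  A * B + (A * y ^+ 2 + B * x ^+ 2) + (x * y) ^+ 2 by ring.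
lra.
Qed.

End RnormScalar.

(** * The Cauchy criterion and norms of limits *)

Section Cauchy.
Context {R : realType} {H : completeNormedModType R[i]}.
Implicit Types u : nat -> H.

Lemma cvgn_seriesP u : cvgn (series u) <->
  forall e : R, 0 < e -> exists N, forall n m, (N <= n)%N -> (n <= m)%N ->
    rnorm (\sum_(n <= k < m) u k) < e.
Proof.
split.
  move=> /cauchy_cvgP/cauchy_seriesP uc e e0.
  have /uc : 0 < e%:C :> R[i] by rewrite ltcR.
  case=> -[A B] [[a _ aA] [b _ bB]] AB.
  exists (maxn a b) => n m; rewrite geq_max => /andP[an bn] nm.
  rewrite -ltcR -rnormE; apply: (AB (n, m)); split => /=.
    exact: aA.
  by apply: bB => /=; exact: leq_trans nm.
move=> uc; apply/cauchy_cvgP/cauchy_seriesP => e e0.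
have eE : e = (complex.Re e)%:C by rewrite RRe_real// gtr0_real.
have /uc[N uN] : 0 < complex.Re e by rewrite -ltcR -eE.
exists ([set n | (N <= n)%N], setT) => /=.
  by split => //=; exists N.
move=> [n m]/= [Nn _]; have [mn|/ltnW nm] := leqP m n.
  by rewrite big_geq// normr0.
by rewrite eE rnormE ltcR uN.
Qed.

Lemma cvgn_rnormP u l : u n @[n --> \oo] --> l ->
  forall e : R, 0 < e -> exists N, forall n, (N <= n)%N -> rnorm (l - u n) < e.
Proof.
move=> /cvgrPdist_lt ul e e0; have /ul : 0 < e%:C :> R[i] by rewrite ltcR.
by case=> N _ uN; exists N => n /uN /=; rewrite rnormE ltcR.
Qed.

Lemma rnorm_limn_le u (C : R) N : cvgn u ->
  (forall n, (N <= n)%N -> rnorm (u n) <= C) -> rnorm (limn u) <= C.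
Proof.
move=> uc uC; apply/ler_addgt0Pl => e /(cvgn_rnormP _ _ uc)[M Me].
rewrite -[limn u](subrK (u (maxn N M))) (le_trans (rnormD _ _))//.
by rewrite lerD ?uC ?leq_maxl// ltW// Me ?leq_maxr.
Qed.

Lemma rnorm_limn_ge u (C : R) N : cvgn u ->
  (forall n, (N <= n)%N -> C <= rnorm (u n)) -> C <= rnorm (limn u).
Proof.
move=> uc uC; apply/ler_addgt0Pl => e /(cvgn_rnormP _ _ uc)[M Me].
rewrite (le_trans (uC (maxn N M) (leq_maxl _ _)))//.
rewrite -[u _](subKr (limn u)) [leRHS]addrC (le_trans (rnormB _ _))// lerD//.
by rewrite ltW// Me ?leq_maxr.
Qed.

Lemma series_bounded u : cvgn (series u) ->
  exists C : R, forall n, rnorm (series u n) <= C.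
Proof.
move=> /cvgn_seriesP /(_ 1 ltr01)[N uN].
exists (\sum_(0 <= k < N) rnorm (u k) + 1) => n; rewrite seriesEnat.
have [nN|Nn] := leqP n N.
  rewrite (le_trans (rnorm_sum _ _ _))//= (big_cat_nat (leq0n n) nN)//= -addrA.
  by rewrite lerDl addr_ge0// sumr_ge0// => k _; exact: rnorm_ge0.
rewrite /= (big_cat_nat (leq0n N) (ltnW Nn))//=.
rewrite (le_trans (rnormD _ _))// lerD ?rnorm_sum//.
by rewrite ltW// uN// ltnW.
Qed.

End Cauchy.

(** * Inner products *)

Section InnerProduct.
Context {R : realType} {H : completeNormedModType R[i]}.
Context {ip : {dot H for (@Num.conj R[i])}}.
Hypothesis norm_ip : forall x : H, `|x| ^+ 2 = ip x x.
Implicit Types x y f g h : H.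

Lemma ipE x : ip x x = (rnorm x ^+ 2)%:C.
Proof. by rewrite -norm_ip rnormE rmorphXn. Qed.

Lemma ip_conj x y : ip x y = Num.conj (ip y x).
Proof. by rewrite hermC expr0 mul1r. Qed.

Lemma rnorm_ipC x y : rnorm (ip x y) = rnorm (ip y x).
Proof. by rewrite ip_conj rnorm_conj. Qed.

Lemma ipZl a x y : ip (a *: x) y = a * ip x y.
Proof. by rewrite linearZl_LR. Qed.

Lemma ipZr a x y : ip x (a *: y) = Num.conj a * ip x y.
Proof. by rewrite linearZr_LR. Qed.

Lemma ip_suml y (I : Type) (r : seq I) (P : pred I) (F : I -> H) :
  ip (\sum_(k <- r | P k) F k) y = \sum_(k <- r | P k) ip (F k) y.
Proof. exact: linear_sumlz. Qed.

Lemma ip_sumr x (I : Type) (r : seq I) (P : pred I) (F : I -> H) :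
  ip x (\sum_(k <- r | P k) F k) = \sum_(k <- r | P k) ip x (F k).
Proof. exact: linear_sumr. Qed.

Lemma rnormD_sqr x y :
  rnorm (x + y) ^+ 2 = rnorm x ^+ 2 + rnorm y ^+ 2 + 2 * complex.Re (ip x y).
Proof.
apply: complexI; rewrite -ipE linearDl/= !linearDr/= !ipE [ip y x]ip_conj.
by rewrite !rmorphD/= -addC_conj -!addrA [Num.conj _ + _]addrC; congr (_ + _);
  rewrite addrCA.
Qed.

Lemma cauchy_schwarz x y : rnorm (ip x y) <= rnorm x * rnorm y.
Proof.
have [->|y0] := eqVneq y 0; first by rewrite linear0r !rnorm0 mulr0.
have y1 : 0 < rnorm y by rewrite lt0r rnorm_eq0 y0 rnorm_ge0.
(* Up to the factor |y|^2, [z] is the component of [x] orthogonal to [y]; the inequality is the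
   nonnegativity of its squared norm. *)
pose z := (rnorm y ^+ 2)%:C *: x - ip x y *: y.
suff zE : rnorm z ^+ 2 =
    rnorm y ^+ 2 * ((rnorm x * rnorm y) ^+ 2 - rnorm (ip x y) ^+ 2).
  rewrite -ler_sqr ?nnegrE ?mulr_ge0 ?rnorm_ge0// -subr_ge0.
  by rewrite -(pmulr_rge0 _ (exprn_gt0 2 y1)) -zE sqr_ge0.
apply: complexI; rewrite exprMn.
have -> (a b c : R) : (a * (b * a - c))%:C = a%:C * (b%:C * a%:C - c%:C).
  by rewrite -rmorphM/= -rmorphB/= -rmorphM.
rewrite -[LHS](ipE z) /z linearBl/= !linearBr/=.
rewrite !ipZl !ipZr !ipE [ip y x]ip_conj.
rewrite -(rnorm_sqrE (ip x y)).
have -> : Num.conj (rnorm y ^+ 2)%:C = (rnorm y ^+ 2)%:C :> R[i].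
  exact: conjc_real.
ring.
Qed.

End InnerProduct.

(** * Square-summable sequences *)

Section SquareSummable.
Context {R : realType}.
Implicit Types (c : nat -> R[i]) (B : R).

Lemma sumr_nat_shrink (a : nat -> R) N n m :
  (forall k, 0 <= a k) -> (m <= N)%N ->
  \sum_(n <= k < m) a k <= \sum_(0 <= k < N) a k.
Proof.
move=> a0 mN; have [nm|/ltnW mn] := leqP n m; last first.
  by rewrite big_geq// sumr_ge0.
rewrite (big_cat_nat (leq0n n) (leq_trans nm mN))/= (big_cat_nat nm mN)/=.
by rewrite addrCA lerDl addr_ge0 ?sumr_ge0.
Qed.

Lemma sqsum_leP c B : (sqsum c <= B%:E)%E <->
  forall N, \sum_(0 <= k < N) rnorm (c k) ^+ 2 <= B.
Proof.
have c0 k : (0 <= (rnorm (c k) ^+ 2)%:E)%E by rewrite lee_fin sqr_ge0.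
split=> [cB N|cB].
  rewrite -lee_fin -sumEFin (le_trans _ cB)//.
  by apply: nneseries_lim_ge => k _ _.
apply: lime_le; first by apply: is_cvg_nneseries => k _ _.
by apply: nearW => N; rewrite sumEFin lee_fin.
Qed.

Lemma in_l2P c : in_l2 c <->
  exists B, forall N, \sum_(0 <= k < N) rnorm (c k) ^+ 2 <= B.
Proof.
split=> [cfin|[B /sqsum_leP cB]]; last first.
  by rewrite /in_l2 (le_lt_trans cB)// ltry.
exists (fine (sqsum c)); apply/sqsum_leP; rewrite fineK// ge0_fin_numE//.
by apply: nneseries_ge0 => k _ _; rewrite lee_fin sqr_ge0.
Qed.

(** A series of nonnegative terms is an unordered sum, which can be reindexed by a bijection. *)
Lemma sqsum_perm c (s : nat -> nat) : bijective s ->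
  sqsum (c \o s) = sqsum c.
Proof.
rewrite -setTT_bijective => sbij.
have c0 d k : (0 <= (rnorm (d k : R[i]) ^+ 2)%:E)%E by rewrite lee_fin sqr_ge0.
by rewrite /sqsum !nneseries_esumT// [RHS](reindex_esum _ _ _ _ sbij).
Qed.

Lemma in_l2_tail c (e : R) : in_l2 c -> 0 < e ->
  exists N, forall n m, (N <= n)%N -> (n <= m)%N ->
    \sum_(n <= k < m) rnorm (c k) ^+ 2 < e.
Proof.
move=> cl2 e0; pose a k := rnorm (c k) ^+ 2.
have a0 k : 0 <= a k by exact: sqr_ge0.
have /cauchy_cvgP/cauchy_seriesP/(_ _ e0)[[P Q] [[N _ NP] [M _ MQ]] PQ] :=
  nnseries_is_cvg a0 cl2.
exists (maxn N M) => n m; rewrite geq_max => /andP[Nn Mn] nm.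
apply: le_lt_trans (ler_norm _) _; apply: (PQ (n, m)); split => /=.
  exact: NP.
by apply: MQ => /=; exact: leq_trans nm.
Qed.

(** Through truncation, inequalities assumed for sequences in l^2 yield inequalities for finite
    sums. *)
Lemma sqsum_truncate c N : sqsum (fun k => if (k < N)%N then c k else 0) =
  (\sum_(0 <= k < N) rnorm (c k) ^+ 2)%:E.
Proof.
apply/eqP; rewrite eq_le; apply/andP; split.
  apply/sqsum_leP => M; have [MN|/ltnW NM] := leqP M N.
    have := sumr_nat_shrink (fun k => rnorm (c k) ^+ 2) N 0 M.
    move=> /(_ (fun k => sqr_ge0 _) MN); apply: le_trans.
    by apply: ler_sum_nat => k /andP[_ kM]; rewrite (leq_trans kM).
  rewrite (big_cat_nat (leq0n N) NM)/= [X in _ + X]big_nat [X in _ + X]big1.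
    by rewrite addr0; apply: ler_sum_nat => k /andP[_ ->].
  by move=> k /andP[Nk _]; rewrite ltnNge Nk/= rnorm0 expr0n.
rewrite (_ : \sum_(0 <= k < N) _ =
    \sum_(0 <= k < N) rnorm (if (k < N)%N then c k else 0) ^+ 2).
  rewrite -sumEFin; apply: nneseries_lim_ge => k _ _.
  by rewrite lee_fin sqr_ge0.
by apply: eq_big_nat => k /andP[_ ->].
Qed.

End SquareSummable.

(** * Bessel sequences: analysis and synthesis *)

Section Bessel.
Context {R : realType} {H : completeNormedModType R[i]}.
Context {ip : {dot H for (@Num.conj R[i])}}.
Hypothesis norm_ip : forall x : H, `|x| ^+ 2 = ip x x.
Implicit Types (x y : nat -> H) (h : H) (c : nat -> R[i]).

Lemma besselP x : bessel ip x <-> exists2 B : R, 0 < B &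
  forall h N, \sum_(0 <= k < N) rnorm (ip h (x k)) ^+ 2 <= B * rnorm h ^+ 2.
Proof.
split=> [[B xB]|[B B0 xB]]; last by exists B => h; apply/sqsum_leP.
(* A positive bound allows division by it later. *)
exists (`|B| + 1); first by rewrite ltr_wpDl.
move=> h N; have /sqsum_leP/(_ N)/le_trans-> // := xB h.
by rewrite ler_wpM2r ?sqr_ge0// (le_trans (ler_norm _))// lerDl.
Qed.

Lemma bessel_in_l2 x h : bessel ip x -> in_l2 (fun k => ip h (x k)).
Proof. by move=> [B xB]; rewrite /in_l2 (le_lt_trans (xB h))// ltry. Qed.

Lemma bessel_perm x (s : nat -> nat) : bijective s ->
  bessel ip x -> bessel ip (x \o s).
Proof.
move=> sbij [B xB]; exists B => h.
by rewrite (sqsum_perm (fun k => ip h (x k)) _ sbij).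
Qed.

(* The converse of [analysis_bound]: the analysis and synthesis operators of [x] are
   adjoint to each other. Here AM-GM replaces the Cauchy-Schwarz inequality. *)
Lemma synthesis_bound x (B : R) : 0 < B ->
  (forall h N, \sum_(0 <= k < N) rnorm (ip h (x k)) ^+ 2 <= B * rnorm h ^+ 2) ->
  forall c n m, rnorm (\sum_(n <= k < m) c k *: x k) ^+ 2 <=
    B * \sum_(n <= k < m) rnorm (c k) ^+ 2.
Proof.
move=> B0 xB c n m; set v := \sum_(_ <= _ < _) _ *: _.
have vE : rnorm v ^+ 2 <= \sum_(n <= k < m) rnorm (c k) * rnorm (ip v (x k)).
  have := normRe_le_rnorm (ip v v).
  rewrite (ipE norm_ip)/= ger0_norm ?sqr_ge0// => /le_trans->//.
  rewrite -[X in rnorm X](ipE norm_ip) {1}/v (ip_suml (ip := ip)).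
  rewrite (le_trans (rnorm_sum _ _ _))// ler_sum// => k _.
  by rewrite ipZl rnormM (rnorm_ipC (ip := ip) v).
have amgm (a b : R) : 2 * (a * b) <= B * a ^+ 2 + B^-1 * b ^+ 2.
  have := sqr_ge0 (B * a - b); have Bi : 0 < B^-1 by rewrite invr_gt0.
  move=> /(mulr_ge0 (ltW Bi)); rewrite sqrrB mulrDr mulrBr.
  have -> : B^-1 * (B * a) ^+ 2 = B * a ^+ 2 by field; exact: lt0r_neq0.
  have -> : B^-1 * (B * a * b *+ 2) = 2 * (a * b) by field; exact: lt0r_neq0.
  lra.
(* After AM-GM in each term, the hypothesis at [v] itself bounds the sum of the |<v, x_k>|^2 / B by
   |v|^2, which the left-hand side absorbs. *)
have : 2 * rnorm v ^+ 2 <=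
    B * (\sum_(n <= k < m) rnorm (c k) ^+ 2) + rnorm v ^+ 2.
  have vB : B^-1 * (\sum_(n <= k < m) rnorm (ip v (x k)) ^+ 2) <= rnorm v ^+ 2.
    rewrite ler_pdivrMl// (le_trans _ (xB v m))// sumr_nat_shrink// => k.
    exact: sqr_ge0.
  rewrite (le_trans _ (lerD (lexx _) vB))// !mulr_sumr -big_split/=.
  rewrite (le_trans (ler_wpM2l _ vE))// mulr_sumr.
  by rewrite ler_sum.
lra.
Qed.

(** By duality: with c_k = <h, x_k> and v the sum of the c_k x_k, the sum s of the |c_k|^2 equals
    <h, v>, so s <= |h| |v|, while |v|^2 <= B s. Squaring and dividing by s gives the bound. *)
Lemma analysis_bound x (B : R) : 0 <= B ->
  (forall c N, rnorm (\sum_(0 <= k < N) c k *: x k) ^+ 2 <=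
    B * \sum_(0 <= k < N) rnorm (c k) ^+ 2) ->
  forall h N, \sum_(0 <= k < N) rnorm (ip h (x k)) ^+ 2 <= B * rnorm h ^+ 2.
Proof.
move=> B0 xB h N; pose c k := ip h (x k); set s := \sum_(_ <= _ < _) _.
pose v := \sum_(0 <= k < N) c k *: x k.
have s0 : 0 <= s by rewrite sumr_ge0// => k _; exact: sqr_ge0.
have sE : ip h v = s%:C.
  rewrite (ip_sumr (ip := ip)) /s rmorph_sum/=; apply: eq_bigr => k _.
  by rewrite ipZr mulrC rnorm_sqrE.
have sle : s <= rnorm h * rnorm v.
  by rewrite -[leLHS](@rnorm_real R)// -sE (cauchy_schwarz norm_ip).
have [->|sn0] := eqVneq s 0; first by rewrite mulr_ge0// sqr_ge0.
have s1 : 0 < s by rewrite lt0r sn0.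
rewrite -(ler_pM2r s1) -expr2 mulrAC.
have /le_trans-> // : s ^+ 2 <= rnorm h ^+ 2 * rnorm v ^+ 2.
  by rewrite -exprMn ler_sqr ?nnegrE ?mulr_ge0 ?rnorm_ge0.
by rewrite mulrC ler_wpM2r ?sqr_ge0// xB.
Qed.

Lemma bessel_cvg x c : bessel ip x -> in_l2 c ->
  cvgn (series (fun k => c k *: x k)).
Proof.
move=> /besselP[B B0 xB] cl2; apply/cvgn_seriesP => e e0.
have e1 : 0 < e ^+ 2 / B by rewrite divr_gt0// exprn_gt0.
have [N cN] := in_l2_tail _ _ cl2 e1; exists N => n m Nn nm.
rewrite -ltr_sqr ?nnegrE ?rnorm_ge0 ?(ltW e0)//.
rewrite (le_lt_trans (synthesis_bound _ _ B0 xB _ _ _))//.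
by rewrite mulrC -ltr_pdivlMr// cN.
Qed.

Lemma bessel_unconditional x c : bessel ip x -> in_l2 c ->
  unconditionally_cvg (fun k => c k *: x k).
Proof.
move=> xB cl2 s sbij; apply: (bessel_cvg (x \o s) (c \o s)).
  exact: bessel_perm.
by rewrite /in_l2 sqsum_perm.
Qed.

End Bessel.

(** * Permutations of the naturals assembled from finite blocks *)

Section BlockPermutation.
Variable L : nat -> seq nat.
Hypothesis L_gt0 : forall b, (0 < size (L b))%N.
Hypothesis L_perm : forall b, perm_eq (L b) (iota b (size (L b))).

Let next b := (b + size (L b))%N.

(** The naturals are tiled by consecutive intervals: the first starts at 0, and one that starts at
    [b] has length [size (L b)]. [start n] is the first element of the tile containing [n]. *)
Let start := fix start n :=
  if n is n'.+1 then if (n < next (start n'))%N then start n' else n else 0%N.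

Let startS n :
  start n.+1 = if (n.+1 < next (start n))%N then start n else n.+1.
Proof. by []. Qed.

Let start_bounds n : (start n <= n < next (start n))%N.
Proof.
elim: n => [|n /andP[sn ns]]; first by rewrite /next /= L_gt0.
rewrite startS; case: ifPn => [->|_]; first by rewrite (leq_trans sn).
by rewrite leqnn/= -[ltnLHS]addn0 ltn_add2l L_gt0.
Qed.

Let start_addn b j : start b = b -> (j < size (L b))%N -> start (b + j) = b.
Proof.
move=> bb; elim: j => [|j IHj] jL; first by rewrite addn0.
by rewrite addnS startS IHj ?(ltnW jL)// -addnS ltn_add2l jL.
Qed.

Let start_start n : start (start n) = start n.
Proof.
elim: n => // n IHn; rewrite startS; case: ifPn => // nn.
by rewrite startS (negPf nn).
Qed.

Let start_block n k : (start n <= k < next (start n))%N -> start k = start n.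
Proof.
move=> /andP[nk kn]; rewrite -(subnKC nk) start_addn ?start_start//.
by rewrite ltn_subLR.
Qed.

Let mem_L b k : (k \in L b) = (b <= k < next b)%N.
Proof. by rewrite (perm_mem (L_perm b)) mem_iota. Qed.

(** On each tile the permutation runs through the list attached to its start; [tau] undoes this by
    looking an entry up in that list. *)
Let sigma n := nth 0%N (L (start n)) (n - start n).
Let tau k := (start k + index k (L (start k)))%N.

Let sub_start n : (n - start n < size (L (start n)))%N.
Proof. by have /andP[? ?] := start_bounds n; rewrite ltn_subLR. Qed.

Let start_sigma n : start (sigma n) = start n.
Proof. by apply: start_block; rewrite -mem_L mem_nth. Qed.

Let start_tau k : start (tau k) = start k.
Proof. by rewrite start_addn ?start_start// index_mem mem_L. Qed.

(** The lists of consecutive tiles, each a rearrangement of its own interval, concatenate to a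
    permutation; any start of a tile serves as [b], and these are unbounded. *)
Lemma block_permutation : exists2 s : nat -> nat, bijective s &
  forall N, exists2 b, (N <= b)%N &
    forall j, (j < size (L b))%N -> s (b + j) = nth 0%N (L b) j.
Proof.
exists sigma.
  exists tau => n.
    rewrite /tau start_sigma index_uniq ?sub_start//.
      by rewrite subnKC//; have /andP[] := start_bounds n.
    by rewrite (perm_uniq (L_perm _)) iota_uniq.
  by rewrite /sigma start_tau addKn nth_index// mem_L.
move=> N; have /andP[sN NS] := start_bounds N.
(* A new tile begins here: the predecessor of this point lies in the tile of [N], and the point
   itself no longer does. *)
exists (next (start N)); first exact: ltnW.
have bb : start (next (start N)) = next (start N).
  have := NS; case E: (next (start N)) => [//|b'] Nb.
  have sb : start b' = start N by apply: start_block; rewrite E (leq_trans sN)/=.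
  by rewrite startS sb E ltnn.
by move=> j jL; rewrite /sigma start_addn// addKn.
Qed.

End BlockPermutation.

(** * Subseries of unconditionally convergent series *)

Section Subseries.
Context {R : realType} {H : completeNormedModType R[i]}.

(* If the subseries were not Cauchy, some blocks of it of norm at least [e]
   could be moved in front of the other terms with indices in the same interval,
   and the rearranged series would diverge. *)
Lemma unconditional_subseries (u : nat -> H) (p : pred nat) :
  unconditionally_cvg u -> cvgn (series (fun k => if p k then u k else 0)).
Proof.
move=> uc; apply/cvgn_seriesP => e e0; apply: contrapT => /forallNP bad.
have {bad}/choice[nm nmP] N : exists nm : nat * nat, [/\ (N <= nm.1)%N,
    (nm.1 <= nm.2)%N & e <= rnorm (\sum_(nm.1 <= k < nm.2 | p k) u k)].
  have /existsNP[n /existsNP[m /not_implyP[Nn /not_implyP[nm]]]] := bad N.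
  by move=> /negP; rewrite -leNgt -big_mkcond => ?; exists (n, m).
pose q b k := ((nm b).1 <= k < (nm b).2)%N && p k.
pose I b := iota b ((nm b).2 - b).+1.
(* The block starting at [b] reaches to the end of the bad stretch found beyond [b] and lists the
   selected indices of that stretch first. *)
pose L b := [seq k <- I b | q b k] ++ [seq k <- I b | ~~ q b k].
have szL b : size (L b) = ((nm b).2 - b).+1.
  by rewrite size_cat !size_filter count_predC size_iota.
have [||s sbij sL] := @block_permutation L.
- by move=> b; rewrite szL.
- by move=> b; rewrite szL /L perm_filterC.
have /cvgn_seriesP/(_ e e0)[N uN] := uc s sbij.
have [b Nb bL] := sL N; have [bn nmb eb] := nmP b.
set F := [seq k <- I b | q b k].
(* The first [size F] terms of this block sum to the bad stretch, of norm at least [e], against the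
   Cauchy criterion for the rearranged series. *)
have := uN b (b + size F)%N Nb (leq_addr _ _).
rewrite ltNge (le_trans eb)// le_eqVlt; apply/orP; left; apply/eqP; congr rnorm.
transitivity (\sum_(k <- F) u k).
  rewrite big_filter /q -[RHS]big_filter_cond.
  apply: perm_big; apply: uniq_perm; rewrite ?filter_uniq ?iota_uniq//.
  move=> k; rewrite mem_filter mem_index_iota mem_iota.
  case: andP => // -[nk km]; rewrite (leq_trans bn)//= addnS ltnS.
  by rewrite subnKC ?(ltnW km)// (leq_trans bn)// ltnW// (leq_ltn_trans nk).
rewrite (big_nth 0%N) -{1}[b]add0n big_addn addKn.
apply: eq_big_nat => j /andP[_ jF].
rewrite /= addnC bL ?nth_cat ?jF//.
by rewrite size_cat (leq_trans jF)// leq_addr.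
Qed.

End Subseries.

(** * Orlicz's theorem and uniform boundedness *)

Section UniformBoundedness.
Context {R : realType} {H : completeNormedModType R[i]}.
Context {ip : {dot H for (@Num.conj R[i])}}.
Hypothesis norm_ip : forall x : H, `|x| ^+ 2 = ip x x.

(** Each sign is decided by the signed sum before it. When v_k is a positive multiple of u_k, the
    new term pushes Re <x, v_k> further from 0, so its modulus grows by Re <u_k, v_k>. *)
Lemma greedy_signs (u v : nat -> H) : exists p : nat -> bool,
  forall k, let x := \sum_(0 <= j < k) (if p j then u j else - u j) in
  if p k then 0 <= complex.Re (ip x (v k)) else complex.Re (ip x (v k)) < 0.
Proof.
pose sgn k x := 0 <= complex.Re (ip x (v k)).
pose x k : H := iteri k (fun k y => y + (if sgn k y then u k else - u k)) 0.
exists (fun k => sgn k (x k)) => k /=.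
suff -> : \sum_(0 <= j < k) (if sgn j (x j) then u j else - u j) = x k.
  by case: ifPn => //; rewrite -ltNge.
elim: k => [|k IHk]; first by rewrite big_geq.
by rewrite big_nat_recr//= IHk.
Qed.

(** Orlicz's theorem in a Hilbert space; the greedy signs make the cross term of each squared norm
    nonnegative. *)
Lemma unconditional_sqsum (u : nat -> H) : unconditionally_cvg u ->
  exists C : R, forall N, \sum_(0 <= k < N) rnorm (u k) ^+ 2 <= C.
Proof.
move=> uc; have [p up] := greedy_signs u u.
have [C1 uC1] := series_bounded _ (unconditional_subseries _ p uc).
have [C2 uC2] := series_bounded _ (unconditional_subseries _ (predC p) uc).
pose x N := \sum_(0 <= k < N) (if p k then u k else - u k).
exists ((C1 + C2) ^+ 2) => N.
have /le_trans-> // : \sum_(0 <= k < N) rnorm (u k) ^+ 2 <= rnorm (x N) ^+ 2.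
  elim: N => [|N IHN]; first by rewrite big_geq// sqr_ge0.
  rewrite big_nat_recr//= /x big_nat_recr//= -/(x N) (rnormD_sqr norm_ip).
  have := up N; rewrite -/(x N) /=; case: ifPn => _ xu.
    by lra.
  rewrite rnormN linearNr/= raddfN/=; lra.
have C0 : 0 <= C1 + C2.
  by rewrite addr_ge0// (le_trans _ (uC1 0%N), le_trans _ (uC2 0%N))// rnorm_ge0.
rewrite ler_sqr ?nnegrE ?rnorm_ge0//.
suff -> : x N = series (fun k => if p k then u k else 0) N -
                series (fun k => if predC p k then u k else 0) N.
  by rewrite (le_trans (rnormB _ _))// lerD.
rewrite !seriesEnat/= -sumrB; apply: eq_bigr => k _ /=.
by case: (p k); rewrite ?subr0 ?sub0r.
Qed.

Lemma geometric_block (n m : nat) : (n <= m)%N ->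
  \sum_(n <= k < m) 3 ^- k <= 3 / 2 * 3 ^- n :> R.
Proof.
move=> nm; suff -> : \sum_(n <= k < m) 3 ^- k = 3 / 2 * (3 ^- n - 3 ^- m) :> R.
  by rewrite ler_wpM2l// gerBl invr_ge0 exprn_ge0.
rewrite -(subnKC nm); elim: (m - n)%N => [|d IHd].
  by rewrite addn0 big_geq// subrr mulr0.
rewrite addnS big_nat_recr ?leq_addr//= IHd exprS invfM.
by field; rewrite !expf_neq0.
Qed.

(* Sokal's gliding hump. The point [f] is the sum of the vectors
   [+-3^-k v_k / |v_k|], with signs such that the partial sum up to [k] has
   an inner product of modulus at least [3^-k |v_k|] with [v_k]; the remaining
   terms can only halve it. *)
Lemma uniform_boundedness {I : Type} (v : I -> H) (w : I -> R) :
  (forall j, 0 <= w j) ->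
  (forall f, exists C : R, forall j, rnorm (ip f (v j)) <= C * w j) ->
  exists C : R, forall j, rnorm (v j) <= C * w j.
Proof.
move=> w0 vw; apply: contrapT => /forallNP unb.
(* The factor 3^k cancels the decay of the k-th term of the series, the factor 2 covers the loss to
   the later terms, and [k] is left to exceed any constant. *)
have {unb}/choice[j jP] (k : nat) :
    exists j, k%:R * 2 * 3 ^+ k * w j < rnorm (v j).
  have /existsNP[j /negP] := unb (k%:R * 2 * 3 ^+ k).
  by rewrite -ltNge; exists j.
have vj0 k : 0 < rnorm (v (j k)).
  by rewrite (le_lt_trans _ (jP k))// !mulr_ge0// exprn_ge0.
pose u k := ((3 ^+ k * rnorm (v (j k)))^-1)%:C *: v (j k).
have uE k : rnorm (u k) = 3 ^- k.
  rewrite rnormZ rnorm_real ?invr_ge0 ?mulr_ge0 ?exprn_ge0 ?rnorm_ge0//.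
  have := vj0 k; move: (rnorm (v (j k))) => r r0.
  by field; rewrite expf_neq0//= lt0r_neq0.
have uv k : complex.Re (ip (u k) (v (j k))) = 3 ^- k * rnorm (v (j k)).
  rewrite ipZl (ipE norm_ip) -rmorphM/=.
  have := vj0 k; move: (rnorm (v (j k))) => r r0.
  by field; rewrite expf_neq0//= lt0r_neq0.
have [p px] := greedy_signs u (v \o j).
pose d k := if p k then u k else - u k.
have dE k : rnorm (d k) = 3 ^- k by rewrite /d; case: ifP; rewrite ?rnormN uE.
have d_block n m : (n <= m)%N ->
    rnorm (\sum_(n <= k < m) d k) <= 3 / 2 * 3 ^- n.
  move=> nm; rewrite (le_trans _ (geometric_block _ _ nm))//.
  by rewrite (le_trans (rnorm_sum _ _ _))// ler_sum// => k _; rewrite dE.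
have dc : cvgn (series d).
  (* From n > 3/2/e and n < 3^n follows 3/2 * 3^-n < e. *)
  apply/cvgn_seriesP => e e0; exists (Num.trunc (3 / 2 / e)).+1 => n m Nn nm.
  rewrite (le_lt_trans (d_block _ _ nm))// ltr_pdivrMr ?exprn_gt0//.
  rewrite -ltr_pdivrMl// mulrC (lt_le_trans (truncnS_gt _))//.
  by rewrite -natrX ler_nat (leq_trans Nn)// ltnW// ltn_expl.
set f := limn (series d).
(* The ratio 3 makes the tail after index [k] at most half of 3^-k, so it cannot cancel the hump. *)
have fx k : rnorm (f - series d k.+1) <= 2^-1 * 3 ^- k.
  apply/ler_addgt0Pl => e /(cvgn_rnormP _ _ dc)[N Ne].
  pose n := maxn N k.+1; rewrite -[f](subrK (series d n)) -addrA.
  rewrite (le_trans (rnormD _ _))// lerD ?(ltW (Ne _ _)) ?leq_maxl//.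
  rewrite !seriesEnat/= (big_cat_nat (leq0n k.+1) (leq_maxr N k.+1))/=.
  rewrite addrAC subrr add0r.
  rewrite (le_trans (d_block _ _ (leq_maxr N k.+1)))// exprS invfM.
  by rewrite le_eqVlt; apply/orP; left; apply/eqP; field; rewrite expf_neq0.
have [C fC] := vw f.
pose k := (Num.trunc C).+1.
have xk : 3 ^- k * rnorm (v (j k)) <= rnorm (ip (series d k.+1) (v (j k))).
  rewrite (le_trans _ (normRe_le_rnorm _))// seriesEnat/= big_nat_recr//=.
  rewrite linearDl/= raddfD/= -uv.
  have := px k; rewrite /d/=; case: ifPn => _ xv.
    by rewrite (le_trans _ (ler_norm _))// lerDr.
  by rewrite linearNl/= raddfN/= -normrN (le_trans _ (ler_norm _))//; lra.
have fv : 2^-1 * 3 ^- k * rnorm (v (j k)) <= rnorm (ip f (v (j k))).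
  have : rnorm (ip (series d k.+1) (v (j k))) <= rnorm (ip f (v (j k))) +
      2^-1 * 3 ^- k * rnorm (v (j k)).
    rewrite -[X in ip X _](subKr f) linearBl/= (le_trans (rnormB _ _))// lerD//.
    by rewrite (le_trans (cauchy_schwarz norm_ip _ _))// ler_wpM2r ?fx ?rnorm_ge0.
  by have := xk; lra.
(* This strict inequality is impossible: [k] was taken above [C], and [w] is nonnegative. *)
have : k%:R * w (j k) < C * w (j k).
  rewrite (lt_le_trans _ (le_trans fv (fC _)))//.
  have q0 : 0 < 2^-1 * 3 ^- k :> R by rewrite mulr_gt0 ?invr_gt0 ?exprn_gt0.
  have := jP k; rewrite -(ltr_pM2l q0); congr (_ < _).
  by field; rewrite expf_neq0.
rewrite ltNge ler_wpM2r//.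
exact/ltW/truncnS_gt.
Qed.

End UniformBoundedness.

(** * Riesz bases and the Bessel criteria for multipliers *)

Section Multipliers.
Context {R : realType} {H : completeNormedModType R[i]}.
Context {ip : {dot H for (@Num.conj R[i])}}.
Hypothesis norm_ip : forall x : H, `|x| ^+ 2 = ip x x.
Implicit Types (x Phi Psi : nat -> H) (m : nat -> R[i]).

(** Uniform boundedness is applied to all finite combinations of the x_k, weighted by the l^2 norm
    of their coefficients; Cauchy-Schwarz gives its pointwise hypothesis. This bounds the synthesis
    operator, hence the analysis operator. *)
Lemma pointwise_in_l2_bessel x :
  (forall h, in_l2 (fun k => ip h (x k))) -> bessel ip x.
Proof.
move=> xl2.
pose v (j : nat * (nat -> R[i])) := \sum_(0 <= k < j.1) j.2 k *: x k.
pose w (j : nat * (nat -> R[i])) :=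
  Num.sqrt (\sum_(0 <= k < j.1) rnorm (j.2 k) ^+ 2).
have w0 j : 0 <= \sum_(0 <= k < j.1) rnorm (j.2 k : R[i]) ^+ 2.
  by rewrite sumr_ge0// => k _; exact: sqr_ge0.
have [||C vC] := uniform_boundedness norm_ip v w.
- by move=> j; exact: sqrtr_ge0.
- move=> f; have /in_l2P[B fB] := xl2 f; exists (Num.sqrt B) => -[N c].
  have B0 : 0 <= B by rewrite (le_trans _ (fB 0%N))// big_geq.
  rewrite -ler_sqr ?nnegrE ?rnorm_ge0 ?mulr_ge0 ?sqrtr_ge0//.
  rewrite exprMn !sqr_sqrtr// /v (ip_sumr (ip := ip))/=.
  have := sum_cauchy_schwarz (fun k => rnorm (ip f (x k)))
    (fun k => rnorm (c k)) N.
  move=> /le_trans/(_ (ler_wpM2r (w0 (N, c)) (fB N))); apply: le_trans.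
  rewrite ler_sqr ?nnegrE ?rnorm_ge0//; last first.
    by rewrite sumr_ge0// => k _; rewrite mulr_ge0 ?rnorm_ge0.
  rewrite (le_trans (rnorm_sum _ _ _))// ler_sum// => k _.
  by rewrite ipZr rnormM rnorm_conj mulrC.
exists (C ^+ 2) => h; apply/sqsum_leP.
apply: (analysis_bound norm_ip); first exact: sqr_ge0.
move=> c N; have := vC (N, c); rewrite /v /w/= => vCN.
rewrite -[X in _ * X](sqr_sqrtr (w0 (N, c))) -exprMn.
rewrite ler_sqr ?nnegrE ?rnorm_ge0//.
exact: le_trans (rnorm_ge0 _) vCN.
Qed.

Lemma riesz_bounds Phi : riesz_basis Phi -> exists A B : R,
  [/\ 0 < A, 0 < B & forall c N, let s := \sum_(0 <= k < N) rnorm (c k) ^+ 2 in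
    A * s <= rnorm (\sum_(0 <= k < N) c k *: Phi k) ^+ 2 <= B * s].
Proof.
move=> [_ [A [B [A0 AB PhiAB]]]]; exists A, B; split=> //.
  exact: lt_le_trans AB.
move=> c N /=; pose t k := if (k < N)%N then c k else 0.
have tE := sqsum_truncate c N.
have [] := PhiAB t; first by rewrite /in_l2 tE ltry.
set s := series _ => sc; rewrite tE -!EFinM !lee_fin.
(* The coefficients vanish from [N] on, so the partial sums are constant there. *)
suff -> : limn s = \sum_(0 <= k < N) c k *: Phi k by move=> -> ->.
apply/eqP; rewrite -subr_eq0 -rnorm_eq0 eq_le rnorm_ge0 andbT.
apply/ler_addgt0Pl => e /(cvgn_rnormP _ _ sc)[M sM]; rewrite addr0.
apply/ltW/(le_lt_trans _ (sM (maxn M N) (leq_maxl _ _))).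
rewrite le_eqVlt; apply/orP; left; apply/eqP; congr (rnorm (_ - _)).
rewrite [RHS](big_cat_nat (leq0n N) (leq_maxr M N))/=.
rewrite [X in _ + X]big_nat [X in _ + X]big1 ?addr0.
  by apply: eq_big_nat => k /andP[_ kN]; rewrite /t kN.
by move=> k /andP[Nk _]; rewrite /t ltnNge Nk scale0r.
Qed.

Lemma riesz_bessel Phi : riesz_basis Phi -> bessel ip Phi.
Proof.
move=> /riesz_bounds[A [B [A0 B0 PhiB]]]; apply/besselP; exists B => //.
apply: (analysis_bound norm_ip); first exact: ltW.
by move=> c N; have /andP[] := PhiB c N.
Qed.

Lemma nbbP (V : normedZmodType R[i]) (x : nat -> V) :
  nbb x <-> exists2 a : R, 0 < a & forall k, a <= rnorm (x k).
Proof.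
split=> [x0|[a a0 xa]].
  exists (inf (range (fun k => rnorm (x k)))) => // k.
  by apply: ge_inf; [exists 0 => _ [n _ <-]; exact: rnorm_ge0|exists k].
rewrite /nbb (lt_le_trans a0)//; apply: lb_le_inf.
  by exists (rnorm (x 0%N)), 0%N.
by move=> _ [n _ <-].
Qed.

Lemma riesz_nbb Phi : riesz_basis Phi -> nbb Phi.
Proof.
move=> /riesz_bounds[A [B [A0 B0 PhiA]]]; apply/nbbP.
exists (Num.sqrt A); first by rewrite sqrtr_gt0.
move=> k; rewrite -ler_sqr ?nnegrE ?sqrtr_ge0 ?rnorm_ge0//.
rewrite sqr_sqrtr ?(ltW A0)//.
(* On the k-th unit sequence the lower Riesz inequality reads A <= |Phi_k|^2. *)
have := PhiA (fun j => (j == k)%:R) k.+1; rewrite /= !big_nat_recr//=.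
rewrite eqxx scale1r !big_nat !big1 ?add0r => [|j|j]; last 2 first.
- by move=> /andP[_ /ltn_eqF->]; rewrite scale0r.
- by move=> /andP[_ /ltn_eqF->]; rewrite rnorm0 expr0n.
rewrite (_ : rnorm 1 = 1); first by rewrite expr1n mulr1 => /andP[].
by rewrite /rnorm normr1.
Qed.

(** Conjugate-linearity in the second argument puts the conjugate of [m k] on the left, so the
    comparison is between moduli. *)
Lemma rnorm_ip_weighted m Psi h k :
  rnorm (ip h (weighted m Psi k)) = rnorm (m k * ip h (Psi k)).
Proof. by rewrite ipZr !rnormM rnorm_conj. Qed.

Lemma in_l2_weighted m Psi h : in_l2 (fun k => ip h (weighted m Psi k)) <->
  in_l2 (fun k => m k * ip h (Psi k)).
Proof.
rewrite /in_l2 (_ : sqsum _ = sqsum (fun k => m k * ip h (Psi k)))//.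
by rewrite /sqsum; apply: eq_eseriesr => k _; rewrite rnorm_ip_weighted.
Qed.

Lemma unconditional_well_defined m Phi Psi :
  mult_unconditional ip m Phi Psi -> mult_well_defined ip m Phi Psi.
Proof. by move=> uc f; apply: (uc f id); exists id. Qed.

Lemma bessel_mult_unconditional m Phi Psi : bessel ip Phi ->
  bessel ip (weighted m Psi) -> mult_unconditional ip m Phi Psi.
Proof.
move=> PhiB mB f.
apply: (bessel_unconditional norm_ip Phi (fun k => m k * ip f (Psi k))) => //.
exact/in_l2_weighted/bessel_in_l2.
Qed.

Lemma bessel_mult_unconditional_swap m Phi Psi : bessel ip Phi ->
  bessel ip (weighted m Psi) -> mult_unconditional ip m Psi Phi.
Proof.
move=> PhiB mB f; rewrite (_ : multiplier_term _ _ _ _ _ =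
    fun k => ip f (Phi k) *: weighted m Psi k).
  exact: (bessel_unconditional norm_ip) (bessel_in_l2 _ _ PhiB).
by apply/funext => k; rewrite /multiplier_term /weighted scalerA mulrC.
Qed.

(** The norm of each term is at least [a] times the modulus of its coefficient, so Orlicz's theorem
    makes the coefficients square-summable. *)
Lemma unconditional_bessel m Phi Psi : nbb Phi ->
  mult_unconditional ip m Phi Psi -> bessel ip (weighted m Psi).
Proof.
move=> /nbbP[a a0 aPhi] uc; apply: pointwise_in_l2_bessel => h.
apply/in_l2_weighted/in_l2P.
have [C hC] := unconditional_sqsum norm_ip _ (uc h).
exists (C / a ^+ 2) => N; rewrite ler_pdivlMr ?exprn_gt0//.
rewrite (le_trans _ (hC N))// mulr_suml ler_sum// => k _.
rewrite [in leRHS]rnormZ exprMn ler_wpM2l ?sqr_ge0//.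
by rewrite ler_sqr ?nnegrE ?rnorm_ge0// ltW.
Qed.

(** A convergent series has bounded partial sums, and the lower Riesz inequality carries this bound
    over to the coefficients. *)
Lemma well_defined_bessel m Phi Psi : riesz_basis Phi ->
  mult_well_defined ip m Phi Psi -> bessel ip (weighted m Psi).
Proof.
move=> /riesz_bounds[A [B [A0 _ PhiA]]] wd; apply: pointwise_in_l2_bessel => h.
apply/in_l2_weighted/in_l2P; have [C hC] := series_bounded _ (wd h).
exists (A^-1 * C ^+ 2) => N; rewrite ler_pdivlMl//.
have /andP[/le_trans-> //] := PhiA (fun k => m k * ip h (Psi k)) N.
have := hC N; rewrite seriesEnat/= => hCN.
by rewrite ler_sqr ?nnegrE ?rnorm_ge0// (le_trans _ hCN) ?rnorm_ge0.
Qed.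

(* The adjoints of the partial sums [T_N] of the multiplier send [g] to
   [\sum_(k < N) conj (m k) <g, Psi k> Phi k]; they are uniformly bounded, and the
   lower Riesz bound turns this into the Bessel bound. *)
Lemma well_defined_swap_bessel m Phi Psi : riesz_basis Phi ->
  mult_well_defined ip m Psi Phi -> bessel ip (weighted m Psi).
Proof.
move=> /riesz_bounds[A [B [A0 _ PhiA]]] wd.
pose c g k := Num.conj (m k) * ip g (Psi k).
pose v (j : nat * H) := \sum_(0 <= k < j.1) c j.2 k *: Phi k.
have [||C vC] := uniform_boundedness norm_ip v (fun j => rnorm j.2).
- by move=> j; exact: rnorm_ge0.
- move=> f; have [C fC] := series_bounded _ (wd f); exists C => -[N g].
  (* Moving the adjoint to the other side bounds the pairing by the partial sums of the convergent
     series at [f]. *)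
  rewrite (_ : ip f _ = ip (series (multiplier_term ip m Psi Phi f) N) g).
    rewrite (le_trans (cauchy_schwarz norm_ip _ _))// ler_wpM2r ?rnorm_ge0//.
  rewrite (ip_sumr (ip := ip)) seriesEnat (ip_suml (ip := ip))/=.
  apply: eq_bigr => k _; rewrite ipZr /c rmorphM/= conjCK -ip_conj.
  by rewrite ipZl mulrAC.
exists (A^-1 * C ^+ 2) => g; apply/sqsum_leP => N.
rewrite -mulrA ler_pdivlMl// -exprMn.
have := vC (N, g); rewrite /v/= => vCN.
have /andP[Ac _] := PhiA (c g) N; apply: le_trans (le_trans Ac _).
  rewrite ler_pM2l// ler_sum// => k _.
  by rewrite rnorm_ip_weighted /c !rnormM rnorm_conj.
by rewrite ler_sqr ?nnegrE ?rnorm_ge0// (le_trans _ vCN) ?rnorm_ge0.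
Qed.

Lemma nbb_weighted_bessel m Psi : nbb m ->
  bessel ip (weighted m Psi) -> bessel ip Psi.
Proof.
move=> /nbbP[a a0 am] /besselP[B B0 mB]; exists (B / a ^+ 2) => h.
apply/sqsum_leP => N; rewrite mulrAC ler_pdivlMr ?exprn_gt0//.
rewrite (le_trans _ (mB h N))// mulr_suml ler_sum// => k _.
rewrite rnorm_ip_weighted rnormM exprMn mulrC ler_wpM2r ?sqr_ge0//.
by rewrite ler_sqr ?nnegrE ?rnorm_ge0// ltW.
Qed.

Lemma linfty_weighted_bessel m Psi : in_linfty m ->
  bessel ip Psi -> bessel ip (weighted m Psi).
Proof.
move=> [b mb] /besselP[B B0 PsiB]; exists (b ^+ 2 * B) => h.
apply/sqsum_leP => N; rewrite -mulrA.
rewrite (le_trans _ (ler_wpM2l _ (PsiB h N))) ?sqr_ge0//.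
rewrite mulr_sumr ler_sum// => k _.
rewrite rnorm_ip_weighted rnormM exprMn ler_wpM2r ?sqr_ge0//.
by rewrite ler_sqr ?nnegrE ?rnorm_ge0// (le_trans _ (mb k)) ?rnorm_ge0.
Qed.

Lemma semi_normalizedP m : semi_normalized m -> nbb m /\ in_linfty m.
Proof.
move=> [a [b [a0 _ mab]]]; split; last by exists b => n; have [] := mab n.
by apply/nbbP; exists a => // n; have [] := mab n.
Qed.

Lemma bessel_norm_bounded x : bessel ip x ->
  exists b : R, forall k, rnorm (x k) <= b.
Proof.
move=> /besselP[B B0 xB]; exists (B + 1) => k.
have [x0|x0] := eqVneq (rnorm (x k)) 0; first by rewrite x0 addr_ge0// ltW.
have x2 : 0 < rnorm (x k) ^+ 2 by rewrite exprn_even_gt0.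
(* The k-th term of the Bessel inequality at x_k itself gives |x_k|^4 <= B |x_k|^2; then 2 |x_k| <=
   |x_k|^2 + 1 yields the bound B + 1. *)
have : rnorm (x k) ^+ 2 <= B.
  rewrite -(ler_pM2r x2); apply: le_trans (xB (x k) k.+1).
  rewrite big_nat_recr//= (ipE norm_ip) rnorm_real ?sqr_ge0// -expr2.
  by rewrite lerDr sumr_ge0// => j _; exact: sqr_ge0.
have := sqr_ge0 (rnorm (x k) - 1); have := rnorm_ge0 (x k).
rewrite sqrrB1; lra.
Qed.

Lemma weighted_bessel_linfty m Psi : nbb Psi ->
  bessel ip (weighted m Psi) -> in_linfty m.
Proof.
move=> /nbbP[a a0 aPsi] /bessel_norm_bounded[b mb]; exists (b / a) => k.
rewrite ler_pdivlMr// (le_trans _ (mb k))// rnormZ.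
by rewrite ler_wpM2l ?rnorm_ge0.
Qed.

(** * Orthonormal bases and the counterexample *)

Lemma onb_rnorm e k : orthonormal_basis ip e -> rnorm (e k) = 1.
Proof.
move=> [ee _]; have := ee k k; rewrite eqxx (ipE norm_ip) => -[/eqP].
rewrite sqrf_eq1 => /orP[/eqP//|/eqP e1].
by have := rnorm_ge0 (e k); rewrite e1 oppr_ge0 ler10.
Qed.

Lemma onb_sum_sqr e (c : nat -> R[i]) n k : orthonormal_basis ip e ->
  rnorm (\sum_(n <= j < k) c j *: e j) ^+ 2 =
  \sum_(n <= j < k) rnorm (c j) ^+ 2.
Proof.
move=> eo; have [ee _] := eo; have [nk|/ltnW kn] := leqP n k; last first.
  by rewrite !big_geq// rnorm0 expr0n.
rewrite -(subnKC nk); elim: (k - n)%N => [|d IHd].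
  by rewrite addn0 !big_geq// rnorm0 expr0n.
rewrite addnS !big_nat_recr ?leq_addr//= (rnormD_sqr norm_ip) IHd.
rewrite rnormZ (onb_rnorm _ _ eo) mulr1 (ip_suml (ip := ip)).
rewrite [X in complex.Re X]big_nat [X in complex.Re X]big1.
  by rewrite mulr0 addr0.
by move=> j /andP[_ jd]; rewrite ipZl ipZr ee ltn_eqF// !mulr0.
Qed.

(** Both constants are 1, by Parseval's identity, obtained from Pythagoras for the partial sums. *)
Lemma onb_riesz e : orthonormal_basis ip e -> riesz_basis e.
Proof.
move=> eo; split; first by case: eo.
exists 1, 1; split=> // c cl2 s.
have eB : bessel ip e.
  apply/besselP; exists 1 => //; apply: (analysis_bound norm_ip) => // d N.
  by rewrite onb_sum_sqr// mul1r.
have sc : cvgn s by exact: (bessel_cvg norm_ip).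
have sE n : rnorm (s n) ^+ 2 = \sum_(0 <= k < n) rnorm (c k) ^+ 2.
  by rewrite /s seriesEnat onb_sum_sqr.
split=> //; rewrite mul1e.
  apply/sqsum_leP => N; rewrite -sE ler_sqr ?nnegrE ?rnorm_ge0//.
  apply: (rnorm_limn_ge _ _ N) => // n Nn.
  rewrite -ler_sqr ?nnegrE ?rnorm_ge0// !sE sumr_nat_shrink// => k.
  exact: sqr_ge0.
have c0 k : (0 <= (rnorm (c k) ^+ 2)%:E)%E by rewrite lee_fin sqr_ge0.
have cfin : (sqsum c) \is a fin_num by rewrite ge0_fin_numE// nneseries_ge0.
rewrite -(fineK cfin) lee_fin.
have T0 : 0 <= fine (sqsum c) by rewrite fine_ge0// nneseries_ge0.
rewrite -(sqr_sqrtr T0) ler_sqr ?nnegrE ?rnorm_ge0 ?sqrtr_ge0//.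
apply: (rnorm_limn_le _ _ 0) => // n _.
rewrite -ler_sqr ?nnegrE ?rnorm_ge0 ?sqrtr_ge0// sqr_sqrtr// sE.
by move: n; apply/sqsum_leP; rewrite fineK.
Qed.

(** At h = e_0 every coefficient has modulus 1, so the partial sums count the terms. *)
Lemma constant_not_bessel e : orthonormal_basis ip e ->
  ~ bessel ip (weighted (fun=> 1) (fun=> e 0%N)).
Proof.
move=> [ee _] /besselP[B _].
move=> /(_ (e 0%N) (Num.trunc (B * rnorm (e 0%N) ^+ 2)).+1).
rewrite (eq_bigr (fun=> 1)) => [|k _]; last first.
  by rewrite rnorm_ip_weighted mul1r ee eqxx /rnorm normr1 expr1n.
by rewrite sumr_const_nat subn0 leNgt truncnS_gt.
Qed.

Lemma onb_nbb_constant e : orthonormal_basis ip e -> nbb (fun=> e 0%N : H).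
Proof.
by move=> eo; apply/nbbP; exists 1 => // _; rewrite (onb_rnorm _ _ eo).
Qed.

Lemma riesz_tfae m Phi Psi : riesz_basis Phi ->
  [<-> mult_well_defined ip m Phi Psi;
       mult_unconditional ip m Phi Psi;
       bessel ip (weighted m Psi);
       mult_well_defined ip m Psi Phi;
       mult_unconditional ip m Psi Phi].
Proof.
(* Each arrow of the cycle starts at, ends at or passes through the Bessel property of
   [weighted m Psi]. *)
move=> PhiR; have PhiB := riesz_bessel _ PhiR; tfae.
- move=> /(well_defined_bessel _ _ _ PhiR); exact: bessel_mult_unconditional.
- exact: unconditional_bessel (riesz_nbb _ PhiR).
- by move=> /(bessel_mult_unconditional_swap _ _ _ PhiB);
    exact: unconditional_well_defined.
- move=> /(well_defined_swap_bessel _ _ _ PhiR).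
  exact: bessel_mult_unconditional_swap.
- move=> /unconditional_well_defined/(well_defined_swap_bessel _ _ _ PhiR).
  move=> /(bessel_mult_unconditional _ _ _ PhiB).
  exact: unconditional_well_defined.
Qed.

End Multipliers.

Theorem proposition3p5 (R : realType) (H : completeNormedModType R[i])
    (ip : {dot H for (@Num.conj R[i])})
    (norm_ip : forall x : H, `|x| ^+ 2 = ip x x)
    (e : nat -> H) (e_onb : orthonormal_basis ip e) :
  (* (i) and its addendum *)
  (forall (Phi Psi : nat -> H) (m : nat -> R[i]),
     nbb Phi -> bessel ip Phi ->
     [/\ mult_unconditional ip m Phi Psi <-> bessel ip (weighted m Psi),
         nbb m ->
           (mult_unconditional ip m Phi Psi -> bessel ip Psi) /\
           (bessel ip (weighted m Psi) -> bessel ip Psi) &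
         semi_normalized m ->
           (mult_unconditional ip m Phi Psi <-> bessel ip Psi) /\
           (bessel ip (weighted m Psi) <-> bessel ip Psi)]) /\
  (* (ii) and its addendum *)
  (forall (Phi Psi : nat -> H) (m : nat -> R[i]),
     riesz_basis Phi ->
     [/\ [<-> mult_well_defined ip m Phi Psi;
              mult_unconditional ip m Phi Psi;
              bessel ip (weighted m Psi);
              mult_well_defined ip m Psi Phi;
              mult_unconditional ip m Psi Phi],
         nbb m ->
           [/\ mult_well_defined ip m Phi Psi -> bessel ip Psi,
               mult_unconditional ip m Phi Psi -> bessel ip Psi,
               bessel ip (weighted m Psi) -> bessel ip Psi,
               mult_well_defined ip m Psi Phi -> bessel ip Psi &
               mult_unconditional ip m Psi Phi -> bessel ip Psi] &
         semi_normalized m ->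
           [/\ mult_well_defined ip m Phi Psi <-> bessel ip Psi,
               mult_unconditional ip m Phi Psi <-> bessel ip Psi,
               bessel ip (weighted m Psi) <-> bessel ip Psi,
               mult_well_defined ip m Psi Phi <-> bessel ip Psi &
               mult_unconditional ip m Psi Phi <-> bessel ip Psi]]) /\
  (* (iii) *)
  [/\ forall (Phi Psi : nat -> H) (m : nat -> R[i]),
        riesz_basis Phi -> nbb Psi ->
        mult_well_defined ip m Phi Psi \/ mult_well_defined ip m Psi Phi ->
        in_linfty m,
      ~ (forall (Phi Psi : nat -> H) (m : nat -> R[i]),
           riesz_basis Phi -> nbb Psi -> in_linfty m ->
           mult_well_defined ip m Phi Psi) &
      ~ (forall (Phi Psi : nat -> H) (m : nat -> R[i]),
           riesz_basis Phi -> nbb Psi -> in_linfty m ->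
           mult_well_defined ip m Psi Phi)] /\
  (* (iv) *)
  (forall (Phi Psi : nat -> H) (m : nat -> R[i]),
     riesz_basis Phi -> riesz_basis Psi ->
     mult_well_defined ip m Phi Psi <-> in_linfty m).
Proof.
have eR := onb_riesz norm_ip _ e_onb.
have e0_nbb := onb_nbb_constant norm_ip _ e_onb.
have e0_linfty : in_linfty (fun=> 1 : R[i]).
  by exists 1 => _; rewrite /rnorm normr1.
(* If this multiplier were well defined, the constant sequence e_0 would be Bessel, as [e] is a
   Riesz basis. *)
have not_wd : ~ mult_well_defined ip (fun=> 1) e (fun=> e 0%N).
  move=> /(well_defined_bessel norm_ip _ _ _ eR).
  exact: constant_not_bessel e_onb.
split; [|split; [|split]].
- move=> Phi Psi m Phi_nbb PhiB.
  have ucB : mult_unconditional ip m Phi Psi <-> bessel ip (weighted m Psi).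
    split; first exact: (unconditional_bessel norm_ip).
    exact: (bessel_mult_unconditional norm_ip).
  split=> // [m_nbb|/semi_normalizedP[m_nbb m_linfty]].
    have mB : bessel ip (weighted m Psi) -> bessel ip Psi.
      exact: nbb_weighted_bessel.
    by split=> // /ucB/mB.
  have mB : bessel ip (weighted m Psi) <-> bessel ip Psi.
    by split; [exact: nbb_weighted_bessel|exact: linfty_weighted_bessel].
  by split=> //; apply: iff_trans mB.
- move=> Phi Psi m PhiR; have T := riesz_tfae norm_ip m Phi Psi PhiR.
  split=> // [m_nbb|/semi_normalizedP[m_nbb m_linfty]].
    have mB : bessel ip (weighted m Psi) -> bessel ip Psi.
      exact: nbb_weighted_bessel.
    split=> // [/(T 0%N 2%N)|/(T 1%N 2%N)|/(T 3%N 2%N)|/(T 4%N 2%N)]; exact: mB.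
  have mB : bessel ip (weighted m Psi) <-> bessel ip Psi.
    by split; [exact: nbb_weighted_bessel|exact: linfty_weighted_bessel].
  split=> //; apply: iff_trans mB.
  + exact: (T 0%N 2%N).
  + exact: (T 1%N 2%N).
  + exact: (T 3%N 2%N).
  + exact: (T 4%N 2%N).
- split.
  + move=> Phi Psi m PhiR Psi_nbb wd.
    apply: (weighted_bessel_linfty norm_ip) Psi_nbb _.
    case: wd; first exact: well_defined_bessel.
    exact: well_defined_swap_bessel.
  + by move=> wd; apply: not_wd; exact: wd.
  (* The same example serves: the two multipliers are well defined simultaneously. *)
  + move=> wd; apply: not_wd; apply/(riesz_tfae norm_ip _ _ _ eR 0%N 3%N).
    exact: wd.
- move=> Phi Psi m PhiR PsiR; split=> [wd|m_linfty].
    apply: (weighted_bessel_linfty norm_ip) (riesz_nbb _ PsiR) _.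
    exact: well_defined_bessel PhiR wd.
  apply: unconditional_well_defined; apply: bessel_mult_unconditional => //.
    exact: (riesz_bessel norm_ip).
  by apply: linfty_weighted_bessel => //; exact: (riesz_bessel norm_ip).
Qed.
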